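(* Let $I\subset\mathbb{R}$ be an interval with interior $I^{\circ}$, let $f:I\to\mathbb{R}$ be twice differentiable on $I^{\circ}$, let $a,b\in I^{\circ}$ with $a<b$, and suppose $f''\in L_1[a,b]$. Let $q>1$ and let $p$ be defined by $\frac1p+\frac1q=1$. Suppose $|f''|^q$ is convex on $[a,b]$. Then $$\left|\frac{1}{b-a}\int_a^b f(x)\,dx-f\left(\frac{a+b}{2}\right)\right|\le\frac{(b-a)^2}{16(2p+1)^{1/p}}\left\{\left(\frac{|f''(a)|^q+3|f''(b)|^q}{4}\right)^{1/q}+\left(\frac{3|f''(a)|^q+|f''(b)|^q}{4}\right)^{1/q}\right\}.$$ If in addition $f'(a)=f'(b)$, then $$\left|\frac{1}{b-a}\int_a^b f(x)\,dx-\frac{f(a)+f(b)}{2}\right|\le\frac{(b-a)^2}{16(2p+1)^{1/p}}\left\{\left(\frac{|f''(a)|^q+3|f''(b)|^q}{4}\right)^{1/q}+\left(\frac{3|f''(a)|^q+|f''(b)|^q}{4}\right)^{1/q}\right\}.$$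
   Context: $L_1[a,b]$ denotes the space of Lebesgue integrable functions on $[a,b]$. *)

(* Defs.v *)
(* The algebra modules are listed one by one: [poly] also defines [f^`()] and
   [f^`(n)] in [ring_scope], which would hide the notations for the derivatives
   of functions. *)
From HB Require Import structures.
From mathcomp Require Export all_boot all_order ssralg ssrnum ssrint interval.
From mathcomp Require Export all_classical all_reals all_analysis.
Export Order.TTheory GRing.Theory Num.Theory.
Export numFieldNormedType.Exports.

(* Main.v *)
From mathcomp Require Import ring lra.
Require Import Defs.

Local Open Scope classical_set_scope.
Local Open Scope ring_scope.

(** Let F be a primitive of f, let c be the midpoint of [a, b], and put
    h = (b - a) / 2.  As a function of its centre s, the second Taylor
    polynomial of F at s, evaluated at a fixed point z,

      T_z(s) = F(s) + (z - s) f(s) + (z - s)^2 / 2 * f'(s),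

    has derivative (s - z)^2 / 2 * f''(s), because the lower-order terms
    telescope.  Both quadrature errors are sums of two increments of such
    functions, one on [a, c] and one on [c, b]:
    - with z = a on [a, c] and z = b on [c, b], the terms in f'(c) cancel and
      the sum is F(b) - F(a) - (b - a) f(c);
    - with z = c on both halves, the sum is F(b) - F(a) -
      (b - a) (f(a) + f(b)) / 2 + h^2 / 2 * (f'(b) - f'(a)), and the last term
      vanishes when f'(a) = f'(b).

    In each case z is an endpoint of the half in question, so Hoelder's
    inequality applied to the integral of (s - z)^2 |f''(s)| over that half
    gives (h^(2p+1) / (2p+1))^(1/p) times (h * m)^(1/q), where m is the mean
    over the half of a bound for |f''|^q.  Convexity bounds |f''|^q by its
    chord, whose mean over a half is its value at the centre of that half,
    namely (3A + B) / 4 and (A + 3B) / 4 with A = |f''(a)|^q and B = |f''(b)|^q.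

    The lemma [holder_increment] is Hoelder's inequality with integrals replaced
    by increments of antiderivatives, and is proved by comparing derivatives
    pointwise.  It applies to T_z directly, which is an antiderivative of
    (s - z)^2 / 2 * f''(s) by construction, so the only integral to evaluate is
    that of the continuous function f. *)

(** * Hoelder's inequality for increments *)

Lemma is_derive1_ext {R : realType} {f g : R -> R} {s a b : R} :
  is_derive s 1 f a -> f =1 g -> a = b -> is_derive s 1 g b.
Proof. by move=> df /funext <- <-. Qed.

Lemma is_derive_subr {R : realType} (z s : R) :
  is_derive s 1 (fun s : R => s - z) 1.
Proof.
apply: (is_derive1_ext (is_deriveB (is_derive_id s 1)
  (is_derive_cst z s 1))) => //.
by rewrite subr0.
Qed.

(** The functions M - E and M + E are both nondecreasing, having the
    nonnegative derivatives m - e and m + e. *)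
Lemma derive_le_increment {R : realType} (u v : R) (E e M m : R -> R) :
  u < v ->
  {within `[u, v], continuous E} -> {within `[u, v], continuous M} ->
  (forall s, s \in `]u, v[ -> is_derive s 1 E (e s)) ->
  (forall s, s \in `]u, v[ -> is_derive s 1 M (m s)) ->
  (forall s, s \in `]u, v[ -> `|e s| <= m s) ->
  `|E v - E u| <= M v - M u.
Proof.
move=> uv cE cM dE dM em.
have uI : u \in `[u, v] by rewrite bound_itvE ltW.
have vI : v \in `[u, v] by rewrite bound_itvE ltW.
have dB s : s \in `]u, v[ -> is_derive s 1 (M \- E) (m s - e s).
  by move=> sI; apply: is_deriveB; [exact: dM|exact: dE].
have dD s : s \in `]u, v[ -> is_derive s 1 (M \+ E) (m s + e s).
  by move=> sI; apply: is_deriveD; [exact: dM|exact: dE].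
have incB : (M \- E) u <= (M \- E) v.
  apply: (@ger0_derive1_le_cc _ _ u v) => //; last exact: ltW.
  - by move=> s /dB [].
  - move=> s sI; rewrite derive1E; have [_ ->] := dB _ sI.
    by have := em _ sI; rewrite ler_norml subr_ge0 => /andP[].
  - by move=> x; apply: continuousB; [exact: cM|exact: cE].
have incD : (M \+ E) u <= (M \+ E) v.
  apply: (@ger0_derive1_le_cc _ _ u v) => //; last exact: ltW.
  - by move=> s /dD [].
  - move=> s sI; rewrite derive1E; have [_ ->] := dD _ sI.
    by have := em _ sI; rewrite ler_norml -subr_ge0 opprK addrC => /andP[].
  - by move=> x; apply: continuousD; [exact: cM|exact: cE].
by move: incB incD => /= incB incD; rewrite ler_norml; apply/andP; split; lra.
Qed.

(** Hoelder's inequality for the integral of k * l, with E, K, L in the role of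
    primitives of e, k^p and l^q.  Young's inequality for k / alpha and
    l / beta bounds |e| by the derivative of
      alpha beta (K / (p alpha^p) + L / (q beta^q)),
    whose increment is at most alpha beta (1/p + 1/q) = alpha beta.  Taking
    alpha and beta as bounds for the norms, rather than the norms themselves,
    allows degenerate cases to be reached by enlarging them. *)
Lemma holder_increment {R : realType} (u v p q alpha beta : R)
    (E e K k L l : R -> R) :
  u < v -> 0 < p -> 0 < q -> p^-1 + q^-1 = 1 ->
  {within `[u, v], continuous E} -> {within `[u, v], continuous K} ->
  {within `[u, v], continuous L} ->
  (forall s, s \in `]u, v[ -> is_derive s 1 E (e s)) ->
  (forall s, s \in `]u, v[ -> is_derive s 1 K (k s `^ p)) ->
  (forall s, s \in `]u, v[ -> is_derive s 1 L (l s `^ q)) ->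
  (forall s, s \in `]u, v[ -> [/\ 0 <= k s, 0 <= l s & `|e s| <= k s * l s]) ->
  0 <= alpha -> 0 <= beta ->
  K v - K u <= alpha `^ p -> L v - L u <= beta `^ q ->
  `|E v - E u| <= alpha * beta.
Proof.
move=> uv p0 q0 pq cE cK cL dE dK dL ekl.
wlog : alpha beta / 0 < alpha /\ 0 < beta.
  move=> pos a0 b0 Ka Lb; apply/ler_addgt0Pr => eps eps0.
  (* Adding d <= 1 to both bounds costs at most d (alpha + beta + 1). *)
  pose d := Num.min 1 (eps / (alpha + beta + 1)).
  have s0 : 0 < alpha + beta + 1 by lra.
  have d0 : 0 < d by rewrite lt_min ltr01 divr_gt0.
  have d1 : d <= 1 by rewrite ge_min lexx.
  have deps : d * (alpha + beta + 1) <= eps.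
    by rewrite -ler_pdivlMr// ge_min lexx orbT.
  apply: (@le_trans _ _ ((alpha + d) * (beta + d))); last first.
    have := ler_wpM2l (ltW d0) d1; nra.
  apply: pos; [split; lra|lra|lra| |].
  - by apply: le_trans Ka _; rewrite ge0_ler_powR ?nnegrE//; lra.
  - by apply: le_trans Lb _; rewrite ge0_ler_powR ?nnegrE//; lra.
move=> [a0 b0] _ _ Ka Lb.
have A0 : 0 < alpha `^ p by rewrite powR_gt0.
have B0 : 0 < beta `^ q by rewrite powR_gt0.
pose x := alpha * beta / (p * alpha `^ p).
pose y := alpha * beta / (q * beta `^ q).
have x0 : 0 <= x by rewrite /x !(mulr_ge0, invr_ge0)// ltW.
have y0 : 0 <= y by rewrite /y !(mulr_ge0, invr_ge0)// ltW.
pose M s := x * K s + y * L s.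
apply: (@le_trans _ _ (M v - M u)).
  apply: (@derive_le_increment _ u v E e M
    (fun s => x * k s `^ p + y * l s `^ q) uv cE _ dE).
  - by move=> s; apply: (continuousD (f := fun s : subspace `[u, v] => x * K s)
        (g := fun s => y * L s));
      apply: continuousM;
      [exact: cst_continuous|exact: cK|exact: cst_continuous|exact: cL].
  - move=> s sI.
    exact: (is_deriveD (is_deriveZ x (dK _ sI)) (is_deriveZ y (dL _ sI))).
  - move=> s sI; have [k0 l0 /le_trans] := ekl _ sI; apply.
    have kp : (k s / alpha) `^ p = k s `^ p / alpha `^ p.
      rewrite -[in RHS](divfK (lt0r_neq0 a0) (k s)).
      by rewrite [in RHS]powRM ?divr_ge0 ?(ltW a0)// mulfK// gt_eqF.
    have lq : (l s / beta) `^ q = l s `^ q / beta `^ q.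
      rewrite -[in RHS](divfK (lt0r_neq0 b0) (l s)).
      by rewrite [in RHS]powRM ?divr_ge0 ?(ltW b0)// mulfK// gt_eqF.
    have := conjugate_powR (divr_ge0 k0 (ltW a0)) (divr_ge0 l0 (ltW b0))
      p0 q0 pq.
    rewrite kp lq -(ler_pM2l (mulr_gt0 a0 b0)) => young.
    have -> : k s * l s = alpha * beta * (k s / alpha * (l s / beta)).
      by field; rewrite !gt_eqF.
    apply: le_trans young _; rewrite le_eqVlt; apply/orP; left; apply/eqP.
    by rewrite /x /y; field; rewrite !gt_eqF.
have -> : alpha * beta = x * alpha `^ p + y * beta `^ q.
  by rewrite -[LHS]mulr1 -pq /x /y; field; rewrite !gt_eqF.
rewrite /M; have := ler_wpM2l x0 Ka; have := ler_wpM2l y0 Lb; lra.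
Qed.

(** * The quadratic kernel *)

(** Writing |y|^(2r) as (y^2)^r gives an antiderivative of it, up to the factor
    2r + 1, by a single formula on both sides of 0; the kernel below can then
    vanish at either end of the interval. *)
Lemma is_derive_mul_powR_sqr {R : realType} (r y : R) : y != 0 ->
  is_derive y 1 (fun y : R => y * (y ^+ 2) `^ r) ((2 * r + 1) * (y ^+ 2) `^ r).
Proof.
move=> y0; have y20 : 0 < y ^+ 2 by rewrite exprn_even_gt0.
have dI : is_derive y 1 (@id R) 1 by exact: is_derive_id.
have dS : is_derive y 1 (fun y : R => y ^+ 2) (2 * y).
  have h := is_deriveX 2 dI.
  by apply: (is_derive_eq h); rewrite /GRing.scale /= mulr1 expr1.
have dP := @is_derive1_comp _ (@powR R ^~ r) (fun y : R => y ^+ 2) y _ _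
  (@is_derive1_powR R r _ y20) dS.
apply: (is_derive_eq (is_deriveM dI dP)).
have -> : (y ^+ 2) `^ (r - 1) = (y ^+ 2) `^ r / y ^+ 2.
  by rewrite powRB ?powRr1 ?(ltW y20)// (gt_eqF y20) implybT.
by rewrite /GRing.scale /=; field.
Qed.

Lemma continuous_mul_powR_sqr {R : realType} (r : R) : 0 <= r ->
  continuous (fun y : R => y * (y ^+ 2) `^ r).
Proof.
move=> r0 y; have [->|y0] := eqVneq y 0; last first.
  apply/differentiable_continuous/derivable1_diffP.
  by have [] := is_derive_mul_powR_sqr r y y0.
rewrite /prop_for /continuous_at mul0r; apply/cvgr0Pnorm_le => e e0.
near=> t.
have t1 : `|t| <= 1.
  near: t; exact: (@cvgr0_norm_le _ R^o R^o _ _ id).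
have te : `|t| <= e.
  near: t; exact: (@cvgr0_norm_le _ R^o R^o _ _ id).
rewrite normrM (le_trans _ te)// ler_piMr// ger0_norm ?powR_ge0//.
have -> : 1 = (1 : R) `^ r by rewrite powR1.
rewrite ge0_ler_powR ?nnegrE ?sqr_ge0//.
by rewrite -real_normK ?num_real// expr_le1.
Unshelve. all: by end_near. Qed.

(** Hoelder's inequality for (s - z)^2 and a majorant of |d| whose q-th power is
    affine.  Over the interval, |s - z|^(2p) integrates to
    (v - u)^(2p+1) / (2p+1) for z at either end, and the affine function
    integrates to (v - u) times its value at the midpoint; as 1/p + 1/q = 1, the
    powers of v - u combine to the cube. *)
Lemma quadratic_kernel_increment {R : realType} (u v z p q x y : R)
    (E d : R -> R) :
  u < v -> z = u \/ z = v -> 0 < p -> 0 < q -> p^-1 + q^-1 = 1 ->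
  {within `[u, v], continuous E} ->
  (forall s, s \in `]u, v[ -> is_derive s 1 E ((s - z) ^+ 2 * d s)) ->
  (forall s, s \in `]u, v[ -> `|d s| `^ q <= x * s + y) ->
  `|E v - E u| <=
    (v - u) ^+ 3 / (2 * p + 1) `^ p^-1 * (x * ((u + v) / 2) + y) `^ q^-1.
Proof.
move=> uv zuv p0 q0 pq cE dE dxy.
have h0 : 0 < v - u by rewrite subr_gt0.
have P0 : 0 < 2 * p + 1 by lra.
set m := x * ((u + v) / 2) + y.
have m0 : 0 <= m.
  apply: le_trans (dxy _ _); [exact: powR_ge0|rewrite in_itv/=; lra].
pose K (s : R) : R := (s - z) * ((s - z) ^+ 2) `^ p / (2 * p + 1).
pose L (s : R) : R := x * s ^+ 2 / 2 + y * s.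
pose al := ((v - u) * ((v - u) ^+ 2) `^ p / (2 * p + 1)) `^ p^-1.
pose be := ((v - u) * m) `^ q^-1.
have alE : al `^ p = (v - u) * ((v - u) ^+ 2) `^ p / (2 * p + 1).
  rewrite -powRrM mulVf ?gt_eqF// powRr1//.
  by rewrite !mulr_ge0 ?powR_ge0 ?invr_ge0 ?(ltW h0) ?(ltW P0).
have beE : be `^ q = (v - u) * m.
  by rewrite -powRrM mulVf ?gt_eqF// powRr1// mulr_ge0// ltW.
have -> : (v - u) ^+ 3 / (2 * p + 1) `^ p^-1 * m `^ q^-1 = al * be.
  have VE : (2 * p + 1)^-1 `^ p^-1 = ((2 * p + 1) `^ p^-1)^-1.
    by rewrite -powR_inv1 ?(ltW P0)// powRAC powR_inv1 ?powR_ge0.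
  have HE : ((v - u) ^+ 2) `^ p `^ p^-1 = (v - u) ^+ 2.
    by rewrite -powRrM mulfV ?gt_eqF// powRr1 ?sqr_ge0.
  have H1 : (v - u) `^ p^-1 * (v - u) `^ q^-1 = v - u.
    rewrite -powRD ?pq ?powRr1 ?(ltW h0)//.
    by rewrite (gt_eqF h0) implybT.
  have : 0 <= ((v - u) ^+ 2) `^ p := powR_ge0 _ _.
  rewrite /al /be; move: HE; set Q := (_ ^+ 2) `^ p => HE Q0.
  rewrite !powRM ?mulr_ge0 ?invr_ge0 ?(ltW h0) ?(ltW P0)// VE HE exprS -{1}H1.
  by ring.
have dL (s : R) : is_derive s 1 L (x * s + y).
  have dI : is_derive s 1 (@id R) 1 by exact: is_derive_id.
  apply: (is_derive1_ext
    (is_deriveD (is_deriveZ (x / 2) (is_deriveX 2 dI)) (is_deriveZ y dI))).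
    by move=> t; rewrite /L !fctE /= /GRing.scale /=; ring.
  by rewrite /GRing.scale /= expr1; field.
have dK (s : R) : s - z != 0 -> is_derive s 1 K (((s - z) ^+ 2) `^ p).
  move=> sz.
  have dP := @is_derive1_comp _ _ (fun s : R => s - z) s _ _
    (is_derive_mul_powR_sqr p _ sz) (is_derive_subr z s).
  apply: (is_derive1_ext (is_deriveZ (2 * p + 1)^-1 dP)).
    by move=> t; rewrite /K !fctE /= /GRing.scale /=; ring.
  by rewrite /GRing.scale /=; field; rewrite gt_eqF.
apply: (@holder_increment _ u v p q al be E _ K (fun s => (s - z) ^+ 2)
  L (fun s => (x * s + y) `^ q^-1) uv p0 q0 pq cE _ _ dE).
- apply: continuous_subspaceT => s.
  apply: (continuousM (s := fun s : R => (s - z) * ((s - z) ^+ 2) `^ p));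
    last first.
    exact: cst_continuous.
  apply: (@continuous_comp _ _ _ (fun s => s - z)
    (fun y : R => y * (y ^+ 2) `^ p)).
    by apply: continuousB; [exact: id|exact: cst_continuous].
  by apply: continuous_mul_powR_sqr; exact: ltW.
- apply: continuous_subspaceT => s.
  by apply/differentiable_continuous/derivable1_diffP; have [] := dL s.
- move=> s sI; apply: dK.
  rewrite subr_eq0; case: zuv => ->; first by rewrite gt_eqF ?(itvP sI).
  by rewrite lt_eqF ?(itvP sI).
- move=> s sI; rewrite -powRrM mulVf ?gt_eqF// powRr1//.
  exact: le_trans (powR_ge0 _ _) (dxy _ sI).
- move=> s sI; split; [exact: sqr_ge0|exact: powR_ge0|].
  rewrite normrM ger0_norm ?sqr_ge0// ler_wpM2l ?sqr_ge0//.
  have -> : `|d s| = (`|d s| `^ q) `^ q^-1.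
    by rewrite -powRrM mulfV ?gt_eqF// powRr1.
  rewrite ge0_ler_powR ?nnegrE ?invr_ge0 ?(ltW q0) ?powR_ge0//; last exact: dxy.
  exact: le_trans (powR_ge0 _ _) (dxy _ sI).
- exact: powR_ge0.
- exact: powR_ge0.
- rewrite alE /K; case: zuv => ->.
    by rewrite subrr !mul0r subr0.
  rewrite subrr !mul0r sub0r -!mulNr opprB.
  by rewrite -[in leLHS](opprB v u) sqrrN.
- by rewrite beE /L /m le_eqVlt; apply/orP; left; apply/eqP; field.
Qed.

(** * The Taylor polynomial as a function of its centre *)

(** When g = f' and f = F', this is twice the second Taylor polynomial of F
    centred at s, evaluated at z; doubling clears the denominator. *)
Definition twice_taylor2 {R : realType} (F f g : R -> R) (z s : R) : R :=
  2 * F s + 2 * (z - s) * f s + (z - s) ^+ 2 * g s.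

(** Moving the centre changes the polynomial only through its top coefficient:
    the derivative of each term cancels part of the previous one. *)
Lemma is_derive_taylor2 {R : realType} (F f g : R -> R) (z s d : R) :
  is_derive s 1 F (f s) -> is_derive s 1 f (g s) -> is_derive s 1 g d ->
  is_derive s 1 (twice_taylor2 F f g z) ((s - z) ^+ 2 * d).
Proof.
move=> dF df dg; have dz := is_derive_subr z s.
have dz2 := is_deriveX 2 dz.
apply: (is_derive1_ext (is_deriveD (is_deriveB (is_deriveZ 2 dF)
  (is_deriveZ 2 (is_deriveM dz df))) (is_deriveM dz2 dg))).
  by move=> t; rewrite /twice_taylor2 !fctE /= /GRing.scale /=; ring.
by rewrite !fctE /GRing.scale /= expr1; ring.
Qed.

Lemma taylor2_increment {R : realType} (u v z p q x y : R) (F f g d : R -> R) :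
  u < v -> z = u \/ z = v -> 0 < p -> 0 < q -> p^-1 + q^-1 = 1 ->
  {within `[u, v], continuous F} -> {within `[u, v], continuous f} ->
  {within `[u, v], continuous g} ->
  (forall s, s \in `]u, v[ -> is_derive s 1 F (f s)) ->
  (forall s, s \in `]u, v[ -> is_derive s 1 f (g s)) ->
  (forall s, s \in `]u, v[ -> is_derive s 1 g (d s)) ->
  (forall s, s \in `]u, v[ -> `|d s| `^ q <= x * s + y) ->
  `|twice_taylor2 F f g z v - twice_taylor2 F f g z u| <=
    (v - u) ^+ 3 / (2 * p + 1) `^ p^-1 * (x * ((u + v) / 2) + y) `^ q^-1.
Proof.
move=> uv zuv p0 q0 pq cF cf cg dF df dg dxy.
apply: (quadratic_kernel_increment u v z p q x y
  (twice_taylor2 F f g z) d uv zuv p0 q0 pq _ _ dxy); last first.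
  by move=> s sI; apply: is_derive_taylor2; [exact: dF|exact: df|exact: dg].
have cz : {within `[u, v], continuous (fun s => z - s)}.
  apply: continuous_subspaceT => s.
  by apply: continuousB; [exact: cst_continuous|exact: id].
have c2 : {within `[u, v], continuous (cst 2 : R -> R)}.
  by apply: continuous_subspaceT => s; exact: cst_continuous.
move=> s; apply: (continuousD (f := fun s : subspace `[u, v] =>
    2 * F s + 2 * (z - s) * f s) (g := fun s => (z - s) ^+ 2 * g s)).
  apply: (continuousD (f := fun s : subspace `[u, v] => 2 * F s)
    (g := fun s => 2 * (z - s) * f s)).
    by apply: (continuousM (s := fun=> 2)); [exact: c2|exact: cF].
  apply: (continuousM (s := fun s : subspace `[u, v] => 2 * (z - s)));
    last exact: cf.
  by apply: (continuousM (s := fun=> 2)); [exact: c2|exact: cz].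
apply: (continuousM (s := fun s : subspace `[u, v] => (z - s) ^+ 2));
  last exact: cg.
by apply: (continuousM (s := fun s : subspace `[u, v] => z - s)); exact: cz.
Qed.

(** * Chords, interiors and primitives *)

Lemma convex_chord {R : realType} (a b : R) (g : R -> R) : a < b ->
  convex_function `[a, b] g ->
  forall s, s \in `[a, b] -> g s <= ((b - s) * g a + (s - a) * g b) / (b - a).
Proof.
move=> ab cg s; rewrite in_itv/= => /andP[as_ sb].
have ba : 0 < b - a by rewrite subr_gt0.
have t0 : 0 <= (b - s) / (b - a) by rewrite divr_ge0 ?subr_ge0// ltW.
have t1 : (b - s) / (b - a) <= 1 by rewrite ler_pdivrMr// mul1r lerD2l lerN2.
have := cg (Itv01 t0 t1) a b.
rewrite !inE /= !in_itv/= !lexx (ltW ab) => /(_ isT isT).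
rewrite !convRE /= /conv /= /GRing.scale /= /unstable.onem.
have -> : (b - s) / (b - a) * a + (1 - (b - s) / (b - a)) * b = s.
  by field; rewrite gt_eqF.
move=> /le_trans; apply; rewrite le_eqVlt; apply/orP; left; apply/eqP.
by field; rewrite gt_eqF.
Qed.

(** Differentiability is known on the interior of I only, so the whole segment
    [a, b] has to lie there: a and b do, and the open interval between them
    is an open subset of I. *)
Lemma itv_sub_interior {R : realType} (I : set R) (a b : R) :
  is_interval I -> I° a -> I° b -> forall s, s \in `[a, b] -> I° s.
Proof.
move=> iI Ia Ib s; rewrite in_itv/= => /andP[].
rewrite le_eqVlt => /predU1P[<-//|as_]; rewrite le_eqVlt => /predU1P[->//|sb].
have abI : `]a, b[ `<=` I.
  move=> x /=; rewrite in_itv/= => /andP[ax xb].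
  apply: (iI a b); [exact: interior_subset|exact: interior_subset|].
  by rewrite !ltW.
have := abI; rewrite (open_subsetE _ (@interval_open _ _ _ _ _))//.
by apply; rewrite /= in_itv/= as_ sb.
Qed.

Lemma continuous_primitive {R : realType} (a b : R) (f : R -> R) : a < b ->
  (forall s, s \in `[a, b] -> {for s, continuous f}) ->
  exists F : R -> R, [/\ {within `[a, b], continuous F},
    forall s, s \in `]a, b[ -> is_derive s 1 F (f s) &
    F b - F a = \int[lebesgue_measure]_(x in `[a, b]) f x].
Proof.
move=> ab cf.
have intf : lebesgue_measure.-integrable `[a, b] (EFin \o f).
  apply: continuous_compact_integrable; first exact: segment_compact.
  by apply: continuous_in_subspaceT => s; rewrite inE; exact: cf.
exists (fun x => \int[lebesgue_measure]_(t in `[a, x]) f t); split.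
- exact: (parameterized_integral_continuous (ltW ab) intf).
- move=> s sI; have [] := @continuous_FTC1_closed _ f a s b _ intf _ _.
  + by rewrite (itvP sI).
  + by rewrite (itvP sI).
  + by apply: cf; exact: subset_itv_oo_cc.
  + by move=> dF; rewrite derive1E => F's; exact: DeriveDef.
- by rewrite set_itv1 Rintegral_set1 subr0.
Qed.

(** * The midpoint and trapezoidal inequalities *)

(** The derivatives of f enter as arbitrary functions g and d, so that
    computations with their values never unfold a limit. *)
Lemma quadrature_error_bounds {R : realType} (f g d : R -> R) (a b p q : R)
  (bound := (b - a) ^+ 2 / (16 * (2 * p + 1) `^ (1 / p)) *
       (((`|d a| `^ q + 3 * `|d b| `^ q) / 4) `^ (1 / q)
        + ((3 * `|d a| `^ q + `|d b| `^ q) / 4) `^ (1 / q))) :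
  a < b -> 1 < q -> 1 / p + 1 / q = 1 ->
  (forall s, s \in `[a, b] -> is_derive s 1 f (g s)) ->
  (forall s, s \in `[a, b] -> is_derive s 1 g (d s)) ->
  convex_function `[a, b] (fun s : R => `|d s| `^ q) ->
  `|1 / (b - a) * (\int[lebesgue_measure]_(x in `[a, b]) f x)
     - f ((a + b) / 2)| <= bound
  /\
  (g a = g b ->
   `|1 / (b - a) * (\int[lebesgue_measure]_(x in `[a, b]) f x)
     - (f a + f b) / 2| <= bound).
Proof.
move=> hab hq hpq df dg hconv.
have p0 : 0 < p.
  rewrite -invr_gt0 -div1r; have -> : 1 / p = 1 - 1 / q by lra.
  by rewrite subr_gt0 ltr_pdivrMr ?mul1r// (lt_trans ltr01).
have q0 : 0 < q := lt_trans ltr01 hq.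
have pq : p^-1 + q^-1 = 1 by move: hpq; rewrite !div1r.
set c := (a + b) / 2.
have ac : a < c by rewrite /c; lra.
have cb : c < b by rewrite /c; lra.
have cf s : s \in `[a, b] -> {for s, continuous f}.
  by move=> /df [h _]; apply/differentiable_continuous/derivable1_diffP.
have cg s : s \in `[a, b] -> {for s, continuous g}.
  by move=> /dg [h _]; apply/differentiable_continuous/derivable1_diffP.
have [F [cF dF FI]] := continuous_primitive a b f hab cf.
pose A := `|d a| `^ q; pose B := `|d b| `^ q.
(* The chord of |f''|^q is s |-> x * s + y. *)
pose x := (B - A) / (b - a); pose y := (b * A - a * B) / (b - a).
have dxy s : s \in `[a, b] -> `|d s| `^ q <= x * s + y.
  move=> /(convex_chord a b _ hab hconv); rewrite -/A -/B.
  suff -> : ((b - s) * A + (s - a) * B) / (b - a) = x * s + y by [].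
  rewrite /x /y; clear x y bound; clearbody A B.
  by field; rewrite subr_eq0 gt_eqF.
have incr u v z : u < v -> a <= u -> v <= b -> z = u \/ z = v ->
    `|twice_taylor2 F f g z v - twice_taylor2 F f g z u| <=
    (v - u) ^+ 3 / (2 * p + 1) `^ p^-1 * (x * ((u + v) / 2) + y) `^ q^-1.
  move=> uv au vb zuv.
  have sub : `[u, v] `<=` `[a, b] by apply: subset_itvScc; rewrite bnd_simp.
  have subo : `]u, v[ `<=` `]a, b[ by apply: subset_itvSoo; rewrite bnd_simp.
  have subc s : s \in `]u, v[ -> s \in `[a, b].
    by move=> sI; apply: sub; exact: subset_itv_oo_cc.
  have cFuv : {within `[u, v], continuous F} by exact: continuous_subspaceW cF.
  have cfuv : {within `[u, v], continuous f}.
    by apply: continuous_in_subspaceT => s /[!inE] sI; apply: cf; exact: sub.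
  have cguv : {within `[u, v], continuous g}.
    by apply: continuous_in_subspaceT => s /[!inE] sI; apply: cg; exact: sub.
  exact: (taylor2_increment u v z p q x y F f g d uv zuv p0 q0 pq cFuv cfuv cguv
    (fun s sI => dF s (subo s sI)) (fun s sI => df s (subc s sI))
    (fun s sI => dg s (subc s sI)) (fun s sI => dxy s (subc s sI))).
set h := (b - a) / 2.
pose C := h ^+ 3 / (2 * p + 1) `^ p^-1.
pose S := ((A + 3 * B) / 4) `^ q^-1 + ((3 * A + B) / 4) `^ q^-1.
have halves z1 z2 : z1 = a \/ z1 = c -> z2 = c \/ z2 = b ->
    `|(twice_taylor2 F f g z2 b - twice_taylor2 F f g z2 c) +
      (twice_taylor2 F f g z1 c - twice_taylor2 F f g z1 a)| <= C * S.
  move=> z1E z2E; apply: le_trans (ler_normD _ _) _.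
  rewrite /S mulrDr; apply: lerD.
    have := incr c b z2 cb (ltW ac) (lexx _) z2E.
    have -> : b - c = h by rewrite /c /h; field.
    suff -> : x * ((c + b) / 2) + y = (A + 3 * B) / 4 by [].
    by rewrite /x /y /c; field; rewrite subr_eq0 gt_eqF.
  have := incr a c z1 ac (lexx _) (ltW cb) z1E.
  have -> : c - a = h by rewrite /c /h; field.
  suff -> : x * ((a + c) / 2) + y = (3 * A + B) / 4 by [].
  by rewrite /x /y /c; field; rewrite subr_eq0 gt_eqF.
(* Dividing by 2 (b - a) = 4 h turns the constant h^3 of [C] into
   h^2 / 4 = (b - a)^2 / 16. *)
have final r : `|2 * (F b - F a) - 2 * (b - a) * r| <= C * S ->
    `|1 / (b - a) * (\int[lebesgue_measure]_(x in `[a, b]) f x) - r| <= bound.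
  have P0 : 0 < (2 * p + 1) `^ p^-1 by rewrite powR_gt0//; lra.
  have ba0 : 0 < 2 * (b - a) by lra.
  rewrite /bound -FI !div1r -/A -/B -/S => bnd; rewrite -(ler_pM2l ba0).
  rewrite -{1}(gtr0_norm ba0) -normrM.
  have -> : 2 * (b - a) * ((b - a)^-1 * (F b - F a) - r) =
      2 * (F b - F a) - 2 * (b - a) * r.
    by field; rewrite subr_eq0 gt_eqF.
  apply: le_trans bnd _; rewrite le_eqVlt; apply/orP; left; apply/eqP.
  by rewrite /C /h; field; rewrite gt_eqF.
split=> [|fab]; apply: final.
  apply: le_trans (halves a b _ _); [|by left|by right].
  rewrite le_eqVlt; apply/orP; left; apply/eqP; congr (`|_|).
  by rewrite /twice_taylor2 /c; field.
apply: le_trans (halves c c _ _); [|by right|by left].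
rewrite le_eqVlt; apply/orP; left; apply/eqP; congr (`|_|).
by rewrite /twice_taylor2 fab /c; field.
Qed.

Theorem corollary3 (R : realType) (I : set R) (f : R -> R) (a b p q : R)
  (hI : is_interval I)
  (hf1 : forall x : R, I° x -> derivable f x 1)
  (hf2 : forall x : R, I° x -> derivable f^`() x 1)
  (ha : I° a) (hb : I° b) (hab : a < b)
  (hL1 : lebesgue_measure.-integrable `[a, b] (fun x : R => (f^`(2) x)%:E))
  (hq : 1 < q) (hpq : 1 / p + 1 / q = 1)
  (hconv : convex_function `[a, b] (fun x : R => `|f^`(2) x| `^ q)) :
  `| (1 / (b - a)) * (\int[lebesgue_measure]_(x in `[a, b]) f x)
     - f ((a + b) / 2) |
    <= (b - a) ^+ 2 / (16 * (2 * p + 1) `^ (1 / p)) *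
       (((`|f^`(2) a| `^ q + 3 * `|f^`(2) b| `^ q) / 4) `^ (1 / q)
        + ((3 * `|f^`(2) a| `^ q + `|f^`(2) b| `^ q) / 4) `^ (1 / q))
  /\
  (f^`() a = f^`() b ->
   `| (1 / (b - a)) * (\int[lebesgue_measure]_(x in `[a, b]) f x)
      - (f a + f b) / 2 |
    <= (b - a) ^+ 2 / (16 * (2 * p + 1) `^ (1 / p)) *
       (((`|f^`(2) a| `^ q + 3 * `|f^`(2) b| `^ q) / 4) `^ (1 / q)
        + ((3 * `|f^`(2) a| `^ q + `|f^`(2) b| `^ q) / 4) `^ (1 / q))).
Proof.
have abI := itv_sub_interior I a b hI ha hb.
have df (s : R) : s \in `[a, b] -> is_derive s 1 f (f^`() s).
  by move=> /abI /hf1; rewrite derive1E => /derivableP.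
have dg (s : R) : s \in `[a, b] -> is_derive s 1 f^`() (f^`(2) s).
  move=> /abI /hf2; rewrite derive1nS derive1n1 [f^`()^`() s]derive1E.
  by move=> /derivableP.
exact: (quadrature_error_bounds f f^`() f^`(2) a b p q hab hq hpq df dg hconv).
Qed.
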